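(* Let $G=(V(G),E(G))$ be a $d$-regular graph on $n$ vertices, and let $\mu=\mu(G)$. Let $\mathcal H$ be the edge-vertex graph of $G$, with input vertex set $I(\mathcal H)=E(G)$ (so $|I(\mathcal H)|=nd/2$) and output vertex set $O(\mathcal H)=V(G)$. For a real number $\alpha>0$ let $c(\alpha)$ be the expansion coefficient of $\mathcal H$ on its input vertices. Then $$c(\alpha)\ \geq\ \frac{4}{\mu+\sqrt{\mu^2+4\alpha(d-\mu)d}}.$$
   Context: Graphs are finite, simple and undirected, with $n\ge 2$ vertices and $d\ge 1$. For a graph $G$ on $n$ vertices with adjacency matrix $A$ and eigenvalues $\lambda_0\ge\lambda_1\ge\cdots\ge\lambda_{n-1}$ of $A$ (with multiplicity), $\mu(G)=\max\{\lambda_1,|\lambda_{n-1}|\}$. The edge-vertex graph $\mathcal H$ of $G$ is the bipartite graph whose input vertices are the edges of $G$ and whose output vertices are the vertices of $G$, an edge $e$ of $G$ being adjacent in $\mathcal H$ to its two endpoints. It has $nd/2$ input vertices, each of degree $2$, and $n$ output vertices, each of degree $d$. For a set $T$ of vertices of $\mathcal H$, $\partial T$ is the set of vertices of $\mathcal H$ adjacent to at least one element of $T$. For $\alpha>0$, the expansion coefficient of $\mathcal H$ on inputs is $$c(\alpha)=\min\left\{\frac{|\partial T|}{|T|}: T\subset I(\mathcal H),\ 0<|T|\le \alpha\,|I(\mathcal H)|\right\};$$ an inequality $c(\alpha)\ge b$ means that $|\partial T|\ge b|T|$ for every such $T$. *)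

(* Defs.v *)
From HB Require Import structures.
From mathcomp Require Import all_boot all_order all_algebra.
From mathcomp Require Import reals constructive_ereal.
From mathcomp Require Import polyrcf.

Set Implicit Arguments.
Unset Strict Implicit.
Unset Printing Implicit Defensive.

Import Order.TTheory GRing.Theory Num.Theory.
Local Open Scope ring_scope.

Record sgraph := SGraph {
  vertex :> finType;
  adj : rel vertex;
  adj_sym : symmetric adj;
  adj_irr : irreflexive adj
}.

Definition regular (G : sgraph) (d : nat) : Prop :=
  forall v : G, #|[set w | adj v w]| = d.

Definition edges (G : sgraph) : {set {set G}} :=
  [set [set p.1; p.2] | p : G * G & adj p.1 p.2].

(* The choice of the enumeration of the vertices does not matter: another one
   conjugates the matrix by a permutation matrix. *)
Definition adjmx (R : realType) (G : sgraph) : 'M[R]_#|G| :=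
  \matrix_(i, j) (adj (enum_val i) (enum_val j))%:R.

(* The real eigenvalues of A in nonincreasing order, each one repeated according
   to its multiplicity as a root of the characteristic polynomial. [rootsR]
   lists the distinct real roots in increasing order. For a symmetric A there
   are n of them; this fact is not built into the definition. *)
Definition spectrum (R : realType) (n : nat) (A : 'M[R]_n) : seq R :=
  rev (flatten [seq nseq (mup x (char_poly A)) x | x <- rootsR (char_poly A)]).

Definition lambda (R : realType) (G : sgraph) (i : nat) : R :=
  (spectrum (adjmx R G))`_i.

Definition mu (R : realType) (G : sgraph) : R :=
  Num.max (lambda R G 1) `|lambda R G #|G|.-1|.

Section EdgeVertex.
Variable G : sgraph.

(* Vertices of the edge-vertex graph: inl e for an edge e of G (an input),
   inr v for a vertex v of G (an output). *)
Definition ev_vertex : finType := ({e : {set G} | e \in edges G} + G)%type.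

Definition ev_adj : rel ev_vertex := fun a b =>
  match a, b with
  | inl e, inr v => v \in val e
  | inr v, inl e => v \in val e
  | _, _ => false
  end.

Lemma ev_adj_sym : symmetric ev_adj.
Proof. by case=> [e|v] [e'|v']. Qed.

Lemma ev_adj_irr : irreflexive ev_adj.
Proof. by case. Qed.

Definition edge_vertex : sgraph := SGraph ev_adj_sym ev_adj_irr.

Definition inputs : {set edge_vertex} :=
  [set inl e | e : {e : {set G} | e \in edges G}].

End EdgeVertex.

Definition boundary (H : sgraph) (T : {set H}) : {set H} :=
  [set y | [exists x in T, adj x y]].

(* c(alpha) for a graph H with set of inputs I. The minimum is taken in \bar R,
   so that it is +oo when no set T is admissible; hence b%:E <= c(alpha) holds
   iff b * |T| <= |boundary T| for every admissible T. *)
Definition expansion_coef (R : realType) (H : sgraph) (I : {set H}) (alpha : R)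
    : \bar R :=
  \big[Order.min/+oo%E]_(T : {set H} |
      [&& T \subset I, (0 < #|T|)%N & #|T|%:R <= alpha * #|I|%:R])
    (#|boundary T|%:R / #|T|%:R)%:E.

(* Main.v *)
(** The endpoints S of a set T of edges span at least [2 |T|] arcs, while the
    expander mixing lemma bounds that number by
    [mu |S| + (d - mu) |S|^2 / n].  Since [|T| <= alpha n d / 2], the ratio
    [x = |S| / |T|] satisfies [4 <= 2 mu x + alpha d (d - mu) x^2], and solving
    this quadratic inequality gives the bound. *)

Require Import Defs.
From mathcomp Require Import all_boot all_order all_algebra.
From mathcomp Require Import reals constructive_ereal.
From mathcomp Require Import polyrcf complex ring lra.

Set Implicit Arguments.
Unset Strict Implicit.
Unset Printing Implicit Defensive.

Import Order.TTheory GRing.Theory Num.Theory.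
Local Open Scope ring_scope.

(** * The spectrum of a real symmetric matrix *)

(** Links [spectrum], built from roots of a polynomial, to the diagonal supplied by the spectral
    theorem: the multiplicity of a root of the product is its count in [s]. *)
Lemma perm_spectrum (R : realType) (n : nat) (A : 'M[R]_n) (s : seq R) :
  char_poly A = \prod_(x <- s) ('X - x%:P) -> perm_eq (spectrum A) s.
Proof.
move=> charA; rewrite /spectrum perm_rev.
have roots_perm : perm_eq (rootsR (char_poly A)) (undup s).
  apply: uniq_perm (uniq_roots _ _ _) (undup_uniq s) _ => x.
  have := roots_on_rootsR (monic_neq0 (char_poly_monic A)) x.
  by rewrite in_itv mem_undup charA root_prod_XsubC.
apply: perm_trans (perm_count_undup s); apply: perm_flatten.
under eq_map => x do rewrite charA mu_prod_XsubC.
by rewrite perm_map // -charA.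
Qed.

Lemma spectrum_sorted (R : realType) (n : nat) (A : 'M[R]_n) :
  sorted (fun x y => y <= x) (spectrum A).
Proof.
rewrite /spectrum rev_sorted.
(* Arbitrary multiplicities [k] free the induction on the list of roots from the polynomial. *)
suff sorted_nseq (k : R -> nat) l : sorted <%R l ->
    sorted <=%R (flatten [seq nseq (k x) x | x <- l]).
  exact: (sorted_nseq (fun x => mup x (char_poly A)) _ (sorted_roots _ _ _)).
rewrite (sorted_pairwise lt_trans) (sorted_pairwise le_trans).
elim: l => //= x l IHl /andP[x_lt /IHl l_sorted].
rewrite pairwise_cat l_sorted andbT; apply/andP; split.
  apply/allrelP => y z /nseqP[-> _] /flatten_mapP[t tl /nseqP[-> _]].
  exact/ltW/(allP x_lt).
by elim: (k x) => //= m ->; rewrite andbT all_nseq lexx orbT.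
Qed.

Lemma char_poly_conj (F : comUnitRingType) (n : nat) (P A : 'M[F]_n) :
  P \in unitmx -> char_poly (invmx P *m A *m P) = char_poly A.
Proof.
move=> Pu.
rewrite /char_poly; have -> : char_poly_mx (invmx P *m A *m P) =
    map_mx polyC (invmx P) *m char_poly_mx A *m map_mx polyC P.
  rewrite /char_poly_mx mulmxBr mulmxBl !map_mxM; congr (_ - _).
  by rewrite -mulmxA -scalar_mxC mulmxA -map_mxM mulVmx // map_mx1 mul1mx.
rewrite !det_mulmx mulrC mulrA -det_mulmx -map_mxM mulmxV // map_mx1 det1.
by rewrite mul1r.
Qed.

(** Over [R[i]] a real symmetric matrix is hermitian, so the complex spectral theorem applies. The
    eigenvalues are real, hence the factorization descends to [R], while [P] stays complex. *)
Lemma symmetric_diagonalization (R : rcfType) (n : nat) (A : 'M[R]_n) :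
  A^T = A ->
  exists (r : 'rV[R]_n) (P : 'M[R[i]]_n),
    [/\ P \is unitarymx,
        map_mx (real_complex R) A =
          invmx P *m diag_mx (map_mx (real_complex R) r) *m P
      & char_poly A = \prod_(i < n) ('X - (r 0 i)%:P)].
Proof.
move=> A_sym; pose B := map_mx (real_complex R) A.
have B_herm : B \is hermsymmx.
  apply: realsym_hermsym.
    by apply/is_hermitianmxP; rewrite expr0 scale1r map_mx_id // map_trmx A_sym.
  by apply/mxOverP => i j; rewrite mxE; apply/complex_realP; exists (A i j).
have diag_real := hermitian_spectral_diag_real B_herm.
have /orthomx_spectralP B_eq := hermitian_normalmx B_herm.
have r_eq : spectral_diag B
    = map_mx (real_complex R) (map_mx (@complex.Re R) (spectral_diag B)).
  by apply/rowP => i; rewrite !mxE RRe_real // (mxOverP diag_real).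
exists (map_mx (@complex.Re R) (spectral_diag B)), (spectralmx B).
split; [exact: spectral_unitarymx | by rewrite -r_eq |].
apply: (map_poly_inj (real_complex R)).
rewrite map_char_poly -/B [in LHS]B_eq char_poly_conj; last first.
  exact/unitarymx_unit/spectral_unitarymx.
rewrite char_poly_trig ?diag_mx_is_trig // rmorph_prod.
apply: eq_bigr => i _ /=; rewrite map_polyXsubC !mxE eqxx mulr1n /=.
by rewrite RRe_real // (mxOverP diag_real).
Qed.

(** * The Rayleigh quotient orthogonally to a top eigenvector *)

Local Open Scope sesquilinear_scope.

(* If the eigenvalue a of u exceeds the second one, it is the first one, and u
   spans its eigenspace, so a vector orthogonal to u only involves the
   remaining eigenvectors. *)
Lemma rayleigh_second (R : realType) (n : nat) (A : 'M[R]_n) (u g : 'rV[R]_n)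
    (a : R) :
  A^T = A -> u *m A = a *: u -> u != 0 -> g *m u^T = 0 ->
  (spectrum A)`_1 < a ->
  (g *m A *m g^T) 0 0 <= (spectrum A)`_1 * (g *m g^T) 0 0.
Proof.
move=> A_sym u_eig u_neq0 g_orth l1_lt.
have [r [P [P_unitary A_eq charA]]] := symmetric_diagonalization A_sym.
have P_inv := invmx_unitary P_unitary.
have P_unit := unitarymx_unit P_unitary.
(* [i0] marks one occurrence of the largest eigenvalue. Only that occurrence is removed, so a
   repeated largest value remains in the tail of the spectrum. *)
have [i0 r_le] : exists i0, forall i, i != i0 -> r 0 i <= (spectrum A)`_1.
  have /perm_spectrum : char_poly A = \prod_(x <- codom (r 0)) ('X - x%:P).
    by rewrite charA big_image.
  have := spectrum_sorted A.
  case: (spectrum A) => [|x s] x_sorted r_perm.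
    have [i _ | no_i] := pickP 'I_n.
      by have := perm_mem r_perm (r 0 i); rewrite codom_f.
    by case/eqP: u_neq0; apply/rowP => i; have := no_i i.
  have [i0 i0_eq] : exists i0, r 0 i0 = x.
    have := perm_mem r_perm x; rewrite mem_head => /esym/codomP[i ->].
    by exists i.
  exists i0 => i i_neq; suff : r 0 i \in s.
    case: s x_sorted {r_perm} => //= y s /andP[_ y_sorted].
    rewrite inE => /predU1P[-> // | r_s].
    have ge_trans : transitive (fun x y : R => y <= x).
      by move=> ? ? ? /[swap]; apply: le_trans.
    exact: (allP (order_path_min ge_trans y_sorted)).
  have r_perm' : perm_eq s [seq r 0 j | j <- rem i0 (enum 'I_n)].
    rewrite -(perm_cons x) (perm_trans r_perm) // -i0_eq -map_cons.
    by rewrite /codom /image_mem perm_map // perm_to_rem // mem_enum.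
  rewrite (perm_mem r_perm') map_f // mem_rem_uniq ?enum_uniq // inE i_neq.
  by rewrite mem_enum.
pose toC m := @map_mx R R[i] (real_complex R) 1 m.
have toC_conj m (v : 'rV[R]_m) : (toC m v)^t* = map_mx (real_complex R) v^T.
  by apply/matrixP => i j; rewrite !mxE [LHS]conjc_real.
(* Coordinates of [v] in the orthonormal eigenbasis formed by the rows of [P]. *)
pose w v := toC n v *m invmx P.
have w_star v : (w v)^t* = P *m (toC n v)^t*.
  by rewrite /w P_inv trmx_mul map_mxM trmxCK.
have w_dot v v' : w v *m (w v')^t* = map_mx (real_complex R) (v *m v'^T).
  by rewrite w_star /w mulmxA mulmxKV // toC_conj -map_mxM.
have entryC v v' : real_complex R ((v *m v'^T) 0 0) =
    \sum_i w v 0 i * (w v' 0 i)^*.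
  have /matrixP/(_ 0 0) := w_dot v v'; rewrite !mxE => <-.
  by apply: eq_bigr => i _; rewrite !mxE.
have w_diag v : w (v *m A) = w v *m diag_mx (map_mx (real_complex R) r).
  by rewrite /w /toC map_mxM A_eq !mulmxA mulmxK.
(* Coordinate [i] of the eigenvector equation says that [r 0 i - a] kills [w u 0 i], and
   [r 0 i < a]. *)
have wu_eq0 i : i != i0 -> w u 0 i = 0.
  move=> /r_le r_i; have := w_diag u; rewrite u_eig.
  move=> /rowP/(_ i); rewrite mul_mx_diag /w /toC map_mxZ -scalemxAl.
  rewrite [LHS]mxE [RHS]mxE !(mxE _ _ 0 i) => /eqP.
  rewrite mulrC -subr_eq0 -mulrBr mulf_eq0 => /orP[/eqP// | ].
  rewrite subr_eq0 => /eqP/complexI a_eq.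
  by move: l1_lt; rewrite a_eq ltNge r_i.
have wu_neq0 : w u 0 i0 != 0.
  apply: contra u_neq0 => /eqP wu0.
  have : w u = 0.
    apply/rowP => i; rewrite [RHS]mxE.
    by have [-> | /wu_eq0] := eqVneq i i0.
  move=> /(congr1 (mulmx^~ P)); rewrite mulmxKV // mul0mx => /eqP.
  by rewrite map_mx_eq0.
(* Only the term at [i0] survives in the inner product of [g] and [u], which is zero. *)
have wg_eq0 : w g 0 i0 = 0.
  have := entryC g u; rewrite g_orth mxE rmorph0 (bigD1 i0) //=.
  rewrite big1 => [|i /wu_eq0 ->]; last by rewrite conjC0 mulr0.
  move/eqP; rewrite addr0 eq_sym mulf_eq0 conjC_eq0 (negbTE wu_neq0) orbF.
  by move/eqP.
rewrite -lecR rmorphM /=.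
rewrite !entryC mulr_sumr; apply: ler_sum => i _.
rewrite w_diag mul_mx_diag mxE [X in _ * X * _]mxE mulrAC [leLHS]mulrC.
have [-> | /r_le r_i] := eqVneq i i0; first by rewrite wg_eq0 !(mul0r, mulr0).
by rewrite ler_wpM2r ?mul_conjC_ge0 // lecR.
Qed.

(** * Adjacency matrices and quadratic forms with constant row sums *)

Lemma adjmx_sym (R : realType) (G : sgraph) : (adjmx R G)^T = adjmx R G.
Proof. by apply/matrixP => i j; rewrite !mxE adj_sym. Qed.

Lemma sum_enum_val (V : nmodType) (T : finType) (F : T -> V) :
  \sum_(i < #|T|) F (enum_val i) = \sum_x F x.
Proof. by rewrite -(big_enum_val (A := T)); apply: eq_bigl. Qed.

Lemma sum_indicator (R : pzSemiRingType) (T : finType) (P : pred T) :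
  \sum_x (P x)%:R = #|[set x | P x]|%:R :> R.
Proof.
rewrite -natr_sum -sum1_card [in RHS]big_mkcond /=; congr _%:R.
by apply: eq_bigr => x _; rewrite inE; case: (P x).
Qed.

Lemma adjmx_row_sum (R : realType) (G : sgraph) (d : nat) (i : 'I_#|G|) :
  regular G d -> \sum_j adjmx R G i j = d%:R.
Proof.
move=> /(_ (enum_val i)) <-; rewrite -sum_indicator -[RHS]sum_enum_val.
by apply: eq_bigr => j _; rewrite mxE.
Qed.

(* Expand [0 <= \sum_i \sum_j A i j * (x_i - e x_j) ^+ 2], where [e] is a sign. *)
Lemma row_sum_form_le (R : realFieldType) (n : nat) (A : 'M[R]_n)
    (x : 'rV[R]_n) (d e : R) :
  A^T = A -> (forall i j, 0 <= A i j) -> (forall i, \sum_j A i j = d) ->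
  e ^+ 2 = 1 -> e * (x *m A *m x^T) 0 0 <= d * (x *m x^T) 0 0.
Proof.
move=> A_sym A_ge0 A_sum e2.
have A_symE i j : A i j = A j i by rewrite -[in LHS]A_sym mxE.
have sq_ge0 : 0 <= \sum_i \sum_j A i j * (x 0 i - e * x 0 j) ^+ 2.
  by do 2!apply: sumr_ge0 => ? _; rewrite mulr_ge0 ?sqr_ge0.
have form : (x *m A *m x^T) 0 0 = \sum_i \sum_j A i j * (x 0 i * x 0 j).
  rewrite mxE; apply: eq_bigr => i _; rewrite !mxE mulr_suml.
  by apply: eq_bigr => j _; rewrite A_symE; ring.
have norm : d * (x *m x^T) 0 0 = \sum_i \sum_j A i j * x 0 i ^+ 2.
  rewrite mxE mulr_sumr; apply: eq_bigr => i _.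
  by rewrite -mulr_suml A_sum mxE expr2.
have norm' : d * (x *m x^T) 0 0 = \sum_i \sum_j A i j * x 0 j ^+ 2.
  rewrite norm exchange_big; apply: eq_bigr => i _.
  by apply: eq_bigr => j _; rewrite A_symE.
suff sum_eq : \sum_i \sum_j A i j * (x 0 i - e * x 0 j) ^+ 2 =
    d * (x *m x^T) 0 0 + d * (x *m x^T) 0 0 - 2 * (e * (x *m A *m x^T) 0 0).
  by move: sq_ge0; rewrite sum_eq; lra.
rewrite {1}norm norm' form !mulr_sumr -big_split -sumrB; apply: eq_bigr => i _.
rewrite !mulr_sumr -big_split -sumrB; apply: eq_bigr => j _ /=.
by rewrite sqrrB exprMn e2; ring.
Qed.

Lemma spectrum_eigenvalue (R : realType) (n : nat) (A : 'M[R]_n) (x : R) :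
  x \in spectrum A -> eigenvalue A x.
Proof.
rewrite mem_rev => /flatten_mapP[y y_root /nseqP[-> _]].
rewrite eigenvalue_root_char.
by move: y_root; rewrite -roots_on_rootsR ?monic_neq0 ?char_poly_monic.
Qed.

(** Guarantees that the indices used in [mu] reach actual eigenvalues and not the default value 0 of
    [nth]. *)
Lemma size_spectrum (R : realType) (n : nat) (A : 'M[R]_n) :
  A^T = A -> size (spectrum A) = n.
Proof.
move=> /symmetric_diagonalization[r [_ [_ _ charA]]].
have /perm_spectrum/perm_size -> :
    char_poly A = \prod_(x <- codom (r 0)) ('X - x%:P).
  by rewrite charA big_image.
by rewrite size_codom card_ord.
Qed.

(** * Eigenvalue bounds for a regular graph *)

Section RegularGraph.
Variables (R : realType) (G : sgraph) (d : nat).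
Hypotheses (G_regular : regular G d) (G_ge2 : (2 <= #|G|)%N).
Let A := adjmx R G.

Lemma adjmx_form_le (x : 'rV[R]_#|G|) (e : R) :
  e ^+ 2 = 1 -> e * (x *m A *m x^T) 0 0 <= d%:R * (x *m x^T) 0 0.
Proof.
apply: row_sum_form_le; first exact: adjmx_sym.
  by move=> i j; rewrite mxE ler0n.
by move=> i; apply: adjmx_row_sum.
Qed.

Lemma spectrum_le_degree (x : R) : x \in spectrum A -> `|x| <= d%:R.
Proof.
move=> /spectrum_eigenvalue/eigenvalueP[v v_eig v_neq0].
have vv_gt0 : 0 < (v *m v^T) 0 0.
  rewrite mxE lt_neqAle eq_sym psumr_neq0 => [|i _]; last first.
    by rewrite mxE -expr2 sqr_ge0.
  rewrite sumr_ge0 ?andbT => [|i _]; last by rewrite mxE -expr2 sqr_ge0.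
  have [i vi_neq0] := rV0Pn _ v_neq0.
  apply/hasP; exists i; first by rewrite mem_index_enum.
  by rewrite mxE -expr2 exprn_even_gt0.
(* The form at the eigenvector [v] is [x] times its squared norm; the signs 1 and -1 bound [x] from
   above and below. *)
have bound e : e ^+ 2 = 1 -> e * x <= d%:R.
  move=> /(adjmx_form_le v); rewrite v_eig -scalemxAl [X in _ * X]mxE mulrA.
  by rewrite ler_pM2r.
rewrite ler_norml -{1}[x]opprK lerN2 -mulN1r -{2}[x]mul1r !bound ?expr1n //.
by rewrite sqrrN expr1n.
Qed.

Lemma mu_le_degree : mu R G <= d%:R.
Proof.
have in_spectrum i : (i < #|G|)%N -> `|lambda R G i| <= d%:R.
  move=> i_lt; apply/spectrum_le_degree/mem_nth.
  by rewrite size_spectrum // adjmx_sym.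
rewrite /mu ge_max (le_trans (ler_norm _)) ?in_spectrum //.
by case: #|G| G_ge2.
Qed.

Lemma mu_ge0 : 0 <= mu R G.
Proof. by rewrite le_max normr_ge0 orbT. Qed.

Lemma const_eigenvector : const_mx 1 *m A = d%:R *: const_mx 1 :> 'rV_#|G|.
Proof.
apply/rowP => j; rewrite !mxE mulr1 -(adjmx_row_sum R j G_regular).
by apply: eq_bigr => i _; rewrite !mxE mul1r adj_sym.
Qed.

Lemma adjmx_form_le_mu (g : 'rV[R]_#|G|) :
  g *m (const_mx 1 : 'rV_#|G|)^T = 0 ->
  (g *m A *m g^T) 0 0 <= mu R G * (g *m g^T) 0 0.
Proof.
move=> g_orth; have gg_ge0 : 0 <= (g *m g^T) 0 0.
  by rewrite mxE sumr_ge0 // => i _; rewrite mxE -expr2 sqr_ge0.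
apply: (@le_trans _ _ (lambda R G 1 * (g *m g^T) 0 0)); last first.
  by rewrite ler_wpM2r // le_max lexx.
(* If the second eigenvalue reaches [d], as for a disconnected graph, the degree bound suffices.
   Otherwise [rayleigh_second] applies to the constant eigenvector, whose eigenvalue is [d]. *)
have [l1_ge | l1_lt] := leP d%:R (lambda R G 1).
  apply: (@le_trans _ _ (d%:R * (g *m g^T) 0 0)); last by rewrite ler_wpM2r.
  by rewrite -[leLHS]mul1r adjmx_form_le ?expr1n.
apply: rayleigh_second g_orth l1_lt; first exact: adjmx_sym.
  exact: const_eigenvector.
by apply/rV0Pn; exists (Ordinal (ltnW G_ge2)); rewrite mxE oner_eq0.
Qed.

(** * Expander mixing *)

(** Ordered pairs are counted, so that the cardinality is the value of the adjacency form at the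
    indicator vector of [S]. *)
Definition arcs (S : {set G}) : {set G * G} :=
  [set p | [&& p.1 \in S, p.2 \in S & adj p.1 p.2]].

(* The expander mixing lemma, one-sided and for a single set. *)
Lemma card_arcs_le (S : {set G}) :
  #|arcs S|%:R <= d%:R * (#|S|%:R ^+ 2 / #|G|%:R)
                  + mu R G * (#|S|%:R - #|S|%:R ^+ 2 / #|G|%:R).
Proof.
have A_sym : A^T = A := adjmx_sym R G.
pose f : 'rV[R]_#|G| := \row_i (enum_val i \in S)%:R.
pose o : 'rV[R]_#|G| := const_mx 1.
have fo : f *m o^T = #|S|%:R%:M.
  rewrite [LHS]mx11_scalar mxE; under eq_bigr do rewrite !mxE mulr1.
  by rewrite (sum_enum_val (fun v => (v \in S)%:R)) sum_indicator cardsE.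
have ff : f *m f^T = #|S|%:R%:M.
  rewrite -fo; apply/matrixP => i j; rewrite !mxE; apply: eq_bigr => k _.
  by rewrite !mxE mulr1 -natrM mulnb andbb.
have oo : o *m o^T = #|G|%:R%:M.
  rewrite [LHS]mx11_scalar mxE; under eq_bigr do rewrite !mxE mulr1.
  by rewrite sumr_const card_ord.
have fAf : f *m A *m f^T = #|arcs S|%:R%:M.
  rewrite [LHS]mx11_scalar; congr _%:M.
  rewrite -sum_indicator -(pair_bigA _
    (fun u v => [&& u \in S, v \in S & adj u v]%:R)) exchange_big /=.
  rewrite -[RHS]sum_enum_val mxE; apply: eq_bigr => j _.
  rewrite -[RHS]sum_enum_val !mxE mulr_suml; apply: eq_bigr => i _.
  by rewrite !mxE -!natrM !mulnb -andbA [adj _ _ && _]andbC.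
(* The density of [S] is the coefficient that makes [f - c *: o] orthogonal to the constant vector
   [o]. *)
pose c : R := #|S|%:R / #|G|%:R.
have n_neq0 : #|G|%:R != 0 :> R by rewrite pnatr_eq0 -lt0n ltnW.
have cn : c * #|G|%:R = #|S|%:R by rewrite divfK.
have of_ : o *m f^T = #|S|%:R%:M by rewrite -[o]trmxK -trmx_mul fo tr_scalar_mx.
have oA := const_eigenvector; rewrite -/o in oA.
have oAo : o *m A *m o^T = (d%:R * #|G|%:R)%:M.
  by rewrite oA -scalemxAl oo scale_scalar_mx.
have oAf : o *m A *m f^T = (d%:R * #|S|%:R)%:M.
  by rewrite oA -scalemxAl of_ scale_scalar_mx.
have fAo : f *m A *m o^T = (d%:R * #|S|%:R)%:M.
  by apply: trmx_inj; rewrite !trmx_mul A_sym trmxK mulmxA oAf tr_scalar_mx.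
(* Expanded, the form is [#|arcs S| - d * c * #|S|] and the squared norm is [#|S| - c * #|S|]. *)
have := @adjmx_form_le_mu (f - c *: o).
rewrite !mulmxBl -!scalemxAl fo oo scale_scalar_mx -raddfB /= cn subrr raddf0.
move=> /(_ (erefl _)); rewrite linearB linearZ /= !mulmxBr -!scalemxAr.
rewrite oAo oAf fAo fAf ff fo of_ oo !scale_scalar_mx !mxE !eqxx !mulr1n.
have cdn : c * (d%:R * #|G|%:R) = d%:R * #|S|%:R by rewrite mulrCA cn.
have -> : #|S|%:R ^+ 2 / #|G|%:R = c * #|S|%:R by rewrite /c; ring.
by rewrite cdn cn !subrr !mulr0 !subr0; lra.
Qed.

(** * Counting edges by their orientations *)

Lemma double_card_edges_le (S : {set G}) (E : {set {set G}}) :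
  E \subset edges G -> (forall e, e \in E -> e \subset S) ->
  (2 * #|E| <= #|arcs S|)%N.
Proof.
move=> E_sub E_S; pose h (p : G * G) := [set p.1; p.2].
(* Arcs lying over no edge of [E] are dropped, and the others are grouped by their edge. Each fibre
   contains both orientations, distinct since there are no loops. *)
rewrite -[#|arcs S|]sum1_card (bigID (fun p => h p \in E)) /=.
apply: leq_trans (leq_addr _ _).
rewrite (partition_big h (mem E)) => [|p /andP[] //] /=.
rewrite mulnC -sum_nat_const; apply: leq_sum => e eE.
have /imsetP[[u v] /=] := subsetP E_sub _ eE; rewrite inE /= => uv e_eq.
have [uS vS] : u \in S /\ v \in S.
  by split; apply: (subsetP (E_S _ eE)); rewrite e_eq !inE eqxx ?orbT.
have uv_neq : u != v by apply: contraTneq uv => ->; rewrite adj_irr.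
rewrite (bigD1 (u, v)) /=; last by rewrite inE /= uS vS uv /h /= -e_eq eE /=.
rewrite (bigD1 (v, u)) //= /h /= setUC -e_eq inE /= uS vS adj_sym uv eE eqxx.
by rewrite xpair_eqE negb_and eq_sym uv_neq.
Qed.

(** With the whole vertex set as [S], regularity gives [#|G| * d] arcs. *)
Lemma double_card_inputs_le : (2 * #|inputs G| <= #|G| * d)%N.
Proof.
rewrite card_imset => [|x y [] //].
have -> : #|{: {e : {set G} | e \in edges G}}| = #|edges G| by rewrite card_sig.
have /(_ setT) := double_card_edges_le (subxx (edges G)).
move=> /(_ (fun e _ => subsetT e))/leq_trans; apply; apply: eq_leq.
rewrite -sum_nat_const -sum1_card.
rewrite (eq_bigl (fun p : G * G => true && adj p.1 p.2)) => [|p]; last first.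
  by rewrite !inE.
rewrite -(pair_big_dep xpredT (fun u v => adj u v) (fun _ _ => 1%N)) /=.
apply: eq_bigr => u _; rewrite -(G_regular u) -sum1_card.
by apply: eq_bigl => v; rewrite inE.
Qed.

Lemma double_card_le_boundary (T : {set edge_vertex G}) : T \subset inputs G ->
  exists S : {set G}, (#|S| <= #|boundary T|)%N /\ (2 * #|T| <= #|arcs S|)%N.
Proof.
move=> T_inputs.
pose E : {set {e : {set G} | e \in edges G}} :=
  [set e | (inl e : edge_vertex G) \in T].
have T_eq : T = [set (inl e : edge_vertex G) | e in E].
  apply/setP => x; apply/idP/imsetP => [xT | [e eE ->]]; last first.
    by rewrite inE in eE.
  have /imsetP[e _ x_eq] := subsetP T_inputs _ xT.
  by exists e => //; rewrite inE -x_eq.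
(* [S] consists of the outputs in the boundary, that is, the endpoints of the edges in [T]. *)
exists [set v | (inr v : edge_vertex G) \in boundary T]; split.
  have inr_inj : injective (inr : G -> edge_vertex G) by move=> x y [].
  rewrite -(card_imset _ inr_inj); apply/subset_leq_card/subsetP => x.
  by move=> /imsetP[v]; rewrite inE => v_bound ->.
rewrite T_eq card_imset => [|x y [] //].
rewrite -(card_imset _ val_inj); apply: double_card_edges_le.
  by apply/subsetP => x /imsetP[e _ ->]; apply: valP.
move=> x /imsetP[e eE ->]; apply/subsetP => v v_e; rewrite !inE.
by rewrite inE in eE; apply/existsP; exists (inl e); rewrite -T_eq eE.
Qed.

End RegularGraph.

(** * The quadratic inequality and the conclusion *)

Lemma root_bound (R : rcfType) (m q x : R) : 0 <= m -> 0 <= q -> 0 <= x ->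
  4 <= 2 * m * x + q * x ^+ 2 -> 4 / (m + Num.sqrt (m ^+ 2 + 4 * q)) <= x.
Proof.
move=> m_ge0 q_ge0 x_ge0 quad.
have disc_ge0 : 0 <= m ^+ 2 + 4 * q by rewrite addr_ge0 ?sqr_ge0 // mulr_ge0.
have := sqr_sqrtr disc_ge0; have := sqrtr_ge0 (m ^+ 2 + 4 * q).
move: (Num.sqrt _) => D D_ge0 D2.
(* The quotient by zero is 0 by convention, and [x] is nonnegative. *)
have [-> | mD_neq0] := eqVneq (m + D) 0; first by rewrite invr0 mulr0.
have mD_gt0 : 0 < m + D by rewrite lt_neqAle eq_sym mD_neq0 addr_ge0.
rewrite ler_pdivrMr // leNgt; apply/negP => lt4.
(* If [x * (m + D) < 4], then [x * D < 4 - m * x]; squaring cancels the terms in [m ^+ 2] and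
   contradicts [quad]. *)
have : (x * D) ^+ 2 < (4 - m * x) ^+ 2.
  by rewrite ltr_pXn2r // ?nnegrE ?mulr_ge0 //; nra.
by rewrite exprMn D2; nra.
Qed.

(** The real arithmetic of the theorem: [i], [t], [s], [b], [a] stand for the sizes of the inputs,
    [T], [S], the boundary of [T] and the arcs in [S]. *)
Lemma boundary_ratio_ge (R : rcfType) (m d alpha n i t s b a : R) :
  0 <= m <= d -> 0 < alpha -> 0 < n -> 0 < t -> 0 <= s <= b ->
  t <= alpha * i -> 2 * i <= n * d -> 2 * t <= a ->
  a <= d * (s ^+ 2 / n) + m * (s - s ^+ 2 / n) ->
  4 / (m + Num.sqrt (m ^+ 2 + 4 * alpha * (d - m) * d)) <= b / t.
Proof.
move=> /andP[m_ge0 m_le] alpha_gt0 n_gt0 t_gt0 /andP[s_ge0 s_le] t_le i_le.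
move=> a_ge a_le.
have d_ge0 : 0 <= d := le_trans m_ge0 m_le.
have b_ge0 : 0 <= b := le_trans s_ge0 s_le.
rewrite -mulrA -mulrA [alpha * _]mulrA.
apply: root_bound; rewrite ?divr_ge0 ?mulr_ge0 ?subr_ge0 ?(ltW alpha_gt0) //.
  exact: ltW.
have b_eq : b = b / t * t by rewrite divfK ?gt_eqF.
move: (b / t) b_eq => x b_eq.
(* This trades one factor [t] of [b ^+ 2 = x ^+ 2 * t ^+ 2] for a constant, leaving a bound linear
   in [t] that can be divided by [t]. *)
have tn_le : t / n <= alpha * d / 2 by rewrite ler_pdivrMr //; nra.
have sn_le : s ^+ 2 / n <= x ^+ 2 * t * (alpha * d / 2).
  apply: (@le_trans _ _ (x ^+ 2 * t * (t / n))); last first.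
    by rewrite ler_wpM2l // mulr_ge0 ?sqr_ge0 // ltW.
  have -> : x ^+ 2 * t * (t / n) = b ^+ 2 / n by rewrite b_eq; ring.
  apply: ler_wpM2r; first by rewrite invr_ge0 ltW.
  by rewrite ler_pXn2r.
have dm_sn_le : (d - m) * (s ^+ 2 / n) <=
    (d - m) * (x ^+ 2 * t * (alpha * d / 2)).
  by rewrite ler_wpM2l ?subr_ge0.
have ms_le : m * s <= m * (x * t) by rewrite ler_wpM2l // -b_eq.
by rewrite -(ler_pM2r t_gt0); lra.
Qed.

Theorem theorem2 (R : realType) (G : sgraph) (n d : nat)
    (hn : #|G| = n) (n_ge2 : (2 <= n)%N) (d_ge1 : (1 <= d)%N)
    (G_regular : regular G d) (alpha : R) (alpha_gt0 : 0 < alpha) :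
  ((4 / (mu R G + Num.sqrt (mu R G ^+ 2 + 4 * alpha * (d%:R - mu R G) * d%:R)))%:E
    <= expansion_coef (inputs G) alpha)%E.
Proof.
(* The bound is checked against the initial value [+oo] and against every admissible [T]. *)
subst n; apply: le_bigmin => [|T /and3P[T_inputs T_gt0 T_le]].
  by rewrite leey.
have [S [S_le arcs_ge]] := double_card_le_boundary T_inputs.
have I_le := double_card_inputs_le G_regular.
rewrite lee_fin.
apply: (@boundary_ratio_ge _ _ _ _ #|G|%:R #|inputs G|%:R _ #|S|%:R _
  #|arcs S|%:R).
- by rewrite mu_ge0 (mu_le_degree R G_regular).
- by [].
- by rewrite ltr0n ltnW.
- by rewrite ltr0n.
- by rewrite ler0n ler_nat.
- by [].
- by rewrite -!natrM ler_nat.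
- by rewrite -natrM ler_nat.
- exact: card_arcs_le.
Qed.
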